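(* Let $\lambda>0$, $V=(V^x,V^y)\in\mathbb{R}^2$, $(s_q,s_{xy})\in\mathbb{R}^2$. Consider the twisted $D_2Q_4$ MRT scheme (relative velocity $\tilde u=0$) with relaxation parameters $(0,s_q,s_q,s_{xy})$ and equilibrium moments $m^{eq}(0)=\rho(1,V^x,V^y,0)$. When $s_q\ne0$, put $\gamma=s_{xy}/s_q$. \begin{itemize} \item If $0\le s_{xy}\le\min(s_q,2-s_q)$ and $s_q\ne0$, the scheme is $L^\infty$ stable for all $V$ such that $|V|_1\le\lambda\gamma$. \item If $s_q\le\min(1,s_{xy})$, $s_{xy}\le2s_q$ and $s_q\ne0$, the scheme is $L^\infty$ stable for all $V$ such that $|V|_1\le\lambda(2-\gamma)$. \item If $s_q\ge\max(1,2-s_{xy})$ and $s_{xy}\le2(2-s_q)$, the scheme is $L^\infty$ stable for all $V$ such that $$|V|_1\le\lambda\Big(\frac4{s_q}-2-\gamma\Big).$$ \item If $s_{xy}=s_q=0$, the scheme is unconditionally $L^\infty$ stable (i.e. for every $V\in\mathbb{R}^2$). \item For all other $(s_q,s_{xy})$, there is no $V$ for which the scheme is $L^\infty$ stable. \end{itemize} In particular, the parameters $(s_q,s_{xy})$ for which the set of $V$ giving an $L^\infty$ stable scheme is non-empty are included in the square $[0,2]^2$.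
   Context: $|V|_1=|V^x|+|V^y|$. Twisted $D_2Q_4$ scheme. Let $\Delta x,\Delta t>0$, $\lambda=\Delta x/\Delta t$, $\mathcal{L}=\Delta x\,\mathbb{Z}^2$. Velocities: $v_0=(\lambda,\lambda)$, $v_1=(-\lambda,\lambda)$, $v_2=(-\lambda,-\lambda)$, $v_3=(\lambda,-\lambda)$. Moment polynomials: $P_0=1$, $P_1=X$, $P_2=Y$, $P_3=XY$. For $\tilde u\in\mathbb{R}^2$, $M(\tilde u)$ is the invertible $4\times4$ matrix $M(\tilde u)_{kj}=P_k(v_j-\tilde u)$. For a distribution vector $f=(f_0,\dots,f_3)$ put $\rho=\sum_jf_j$ and $m=M(\tilde u)f$. One time step of the scheme relative to $\tilde u$ with relaxation parameters $(s_0,\dots,s_3)$ is: relaxation at each node $m_k^*=m_k+s_k(m_k^{eq}-m_k)$, where $m^{eq}$ is a given linear function of $\rho$; $f^*=M(\tilde u)^{-1}m^*$; transport $f_j(x,t+\Delta t)=f_j^*(x-v_j\Delta t,t)$, $x\in\mathcal{L}$. $L^\infty$ stability. The mass is $m_{tot}(t)=\sum_{x\in\mathcal{L}}\sum_jf_j(x,t)$. The scheme is $L^\infty$ stable if, for $C>0$ and every initial datum with $f_j(x,0)\ge0$ for all $j$, $x\in\mathcal{L}$ and $m_{tot}(0)\le C$, one has $f_j(x,t^n)\ge0$ for all $j$, $x\in\mathcal{L}$ and $m_{tot}(t^n)\le C$ for all $t^n=n\Delta t$, $n\in\mathbb{N}$. *)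

(* Defs.v *)
From HB Require Import structures.
From mathcomp Require Import all_boot all_order all_algebra.
From mathcomp Require Import all_classical all_reals all_analysis.

Set Implicit Arguments.
Unset Strict Implicit.
Unset Printing Implicit Defensive.

Import Order.TTheory GRing.Theory Num.Theory.

Local Open Scope classical_set_scope.
Local Open Scope ring_scope.

Section TwistedD2Q4.
Variable R : realType.

Definition vec2 (a b : R) : 'rV[R]_2 := \row_i [:: a; b]`_i.

Definition norm1 (V : 'rV[R]_2) : R := `|V 0 0| + `|V 0 1|.

(* The lattice dx Z^2, as a subset of the plane. *)
Definition lattice (dx : R) : set 'rV[R]_2 :=
  [set dx *: map_mx intr z | z in [set: 'rV[int]_2]].

Definition velocity (lam : R) (j : 'I_4) : 'rV[R]_2 :=
  nth 0 [:: vec2 lam lam; vec2 (- lam) lam;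
            vec2 (- lam) (- lam); vec2 lam (- lam)] j.

(* The polynomials 1, X, Y, XY evaluated at w = (X, Y). *)
Definition moment_poly (k : 'I_4) (w : 'rV[R]_2) : R :=
  [:: 1; w 0 0; w 0 1; w 0 0 * w 0 1]`_k.

Definition moment_mx (lam : R) (u : 'rV[R]_2) : 'M[R]_4 :=
  \matrix_(k, j) moment_poly k (velocity lam j - u).

Definition density (f : 'cV[R]_4) : R := \sum_j f j 0.

(* The equilibrium moments, linear in the density rho, are rho *: E. *)
Definition relax_moments (s E : 'cV[R]_4) (rho : R) (m : 'cV[R]_4) : 'cV[R]_4 :=
  \col_k (m k 0 + s k 0 * ((rho *: E) k 0 - m k 0)).

Definition collide (lam : R) (u : 'rV[R]_2) (s E f : 'cV[R]_4) : 'cV[R]_4 :=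
  invmx (moment_mx lam u)
    *m relax_moments s E (density f) (moment_mx lam u *m f).

(* A distribution assigns (f_0, ..., f_3) to each point of the plane; only its
   values on the lattice matter, since dt *: velocity lam j is a lattice vector
   when lam = dx / dt. *)
Definition distribution := 'rV[R]_2 -> 'cV[R]_4.

Definition lbm_step (lam dt : R) (u : 'rV[R]_2) (s E : 'cV[R]_4)
    (f : distribution) : distribution :=
  fun x => \col_j collide lam u s E (f (x - dt *: velocity lam j)) j 0.

Definition nonneg_on_lattice (dx : R) (f : distribution) : Prop :=
  forall x, x \in lattice dx -> forall j, 0 <= f x j 0.

(* \esum is the supremum of the finite partial sums, i.e. the sum of the family
   in [0, +oo] when f is nonnegative on the lattice; it is only used then. *)
Definition total_mass (dx : R) (f : distribution) : \bar R :=
  \esum_(x in lattice dx) (\sum_j f x j 0)%:E.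

Definition Linfty_stable (dx : R) (step : distribution -> distribution) : Prop :=
  forall C : R, 0 < C ->
  forall f : distribution,
    nonneg_on_lattice dx f -> (total_mass dx f <= C%:E)%E ->
  forall n : nat,
    nonneg_on_lattice dx (iter n step f) /\
    (total_mass dx (iter n step f) <= C%:E)%E.

Definition vec4 (a b c d : R) : 'cV[R]_4 := \col_k [:: a; b; c; d]`_k.

Definition twisted_D2Q4 (lam dt sq sxy : R) (V : 'rV[R]_2) :
    distribution -> distribution :=
  lbm_step lam dt 0 (vec4 0 sq sq sxy) (vec4 1 (V 0 0) (V 0 1) 0).

End TwistedD2Q4.

(* Main.v *)
Require Import Defs.
From mathcomp Require Import all_boot all_order all_algebra.
From mathcomp Require Import all_classical all_reals all_analysis.
From mathcomp Require Import ring lra.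

Set Implicit Arguments.
Unset Strict Implicit.
Unset Printing Implicit Defensive.

Import Order.TTheory GRing.Theory Num.Theory.

Local Open Scope ring_scope.

(** One step of the scheme applies the same 4 x 4 matrix K to the distribution
    vector at each node, then moves the i-th component by the lattice vector
    dt v_i.  Stability is therefore equivalent to K having nonnegative entries
    ([Linfty_stable_transport]).  The relaxation parameter of the density is 0
    and the equilibrium has density rho, so the columns of K sum to 1: when K
    is nonnegative, positivity propagates and the mass does not change.
    Conversely a unit mass placed in component j of the node 0 is spread by one
    step into the j-th column of K, so a stable scheme has K >= 0.

    The matrix K is explicit because the moment matrix is a diagonal matrix
    times the Hadamard matrix of signs of 1, X, Y, XY at the four corners
    ([collideE]).  With e_i the sign vector of v_i, the entries satisfy
      4 lam K_ij = lam c_ij + sq (e_i . V),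
    where c_ij is 4 - 2 sq - sxy if j = i, 2 sq - sxy if j is opposite to i,
    and sxy if j is adjacent to i ([twisted_mx_margin]).  Over the four corners
    e_i . V takes both values |V|_1 and - |V|_1, its extreme ones, and every row
    contains the three constants.  Hence the scheme is stable exactly when
      |sq| |V|_1 <= lam min(sxy, 2 sq - sxy, 4 - 2 sq - sxy)
    ([twisted_stableP]).  Some V satisfies this only if the minimum is
    nonnegative, which describes the triangle with vertices (0, 0), (1, 2) and
    (2, 0) in the (sq, sxy) plane.  The first three regions cut this triangle,
    without the vertex (0, 0), according to which of the three terms realizes
    the minimum; dividing that term by sq gives the stated bound.  At (0, 0)
    the inequality reads 0 <= 0 for every V. *)

(** * Schemes that mix linearly at each node and then transport *)

Section TransportSchemes.
Variables (R : realType) (dx : R).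
Implicit Types (x y : 'rV[R]_2) (f : Defs.distribution R).

Lemma lattice0 : 0 \in lattice dx.
Proof. by rewrite inE; exists 0 => //; rewrite raddf0 scaler0. Qed.

Lemma latticeB x y : x \in lattice dx -> y \in lattice dx -> x - y \in lattice dx.
Proof.
rewrite !inE => -[z _ <-] [z' _ <-]; exists (z - z') => //.
by rewrite raddfB scalerBr.
Qed.

Lemma latticeN y : y \in lattice dx -> - y \in lattice dx.
Proof. by move=> yL; rewrite -sub0r latticeB ?lattice0. Qed.

Definition transport_step (K : 'M[R]_4) (w : 'I_4 -> 'rV[R]_2)
    (f : Defs.distribution R) : Defs.distribution R :=
  fun x => \col_i (K *m f (x - w i)) i 0.

(** The mass of each component is unchanged by its transport, because a
    translation by a lattice vector permutes the lattice. *)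
Lemma esum_lattice_shift (w : 'rV[R]_2) (g : 'rV[R]_2 -> \bar R) :
  w \in lattice dx ->
  (\esum_(x in lattice dx) g (x - w)%R = \esum_(x in lattice dx) g x)%E.
Proof.
move=> wL; symmetry; apply: (@reindex_esum _ _ _ _ _ (fun x : 'rV[R]_2 => x - w)).
split=> [x /mem_set xL | x y _ _ | y /mem_set yL].
- by apply: set_mem; rewrite latticeB.
- exact: addIr.
exists (y + w); last by rewrite addrK.
by apply: set_mem; rewrite -[w]opprK latticeB ?latticeN.
Qed.

Variables (K : 'M[R]_4) (w : 'I_4 -> 'rV[R]_2).
Hypothesis wL : forall i, w i \in lattice dx.

Lemma transport_step_ge0 f : (forall i j, 0 <= K i j) ->
  nonneg_on_lattice dx f -> nonneg_on_lattice dx (transport_step K w f).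
Proof.
move=> K0 f0 x xL i; rewrite !mxE; apply: sumr_ge0 => j _.
by rewrite mulr_ge0 ?f0 ?latticeB.
Qed.

(** Summing over the lattice first removes the shifts, which differ from one
    component to another; the column sums of K then act node by node. *)
Lemma total_mass_transport f :
    (forall i j, 0 <= K i j) -> (forall j, \sum_i K i j = 1) ->
    nonneg_on_lattice dx f ->
  total_mass dx (transport_step K w f) = total_mass dx f.
Proof.
move=> K0 K1 f0.
have Kf0 i x : x \in lattice dx -> 0 <= (K *m f x) i 0.
  by move=> xL; rewrite mxE sumr_ge0// => j _; rewrite mulr_ge0 ?f0.
rewrite /total_mass.
transitivity (\sum_i \esum_(x in lattice dx) ((K *m f (x - w i)) i 0)%R%:E)%E.
  rewrite -esum_sum; last by move=> x i /mem_set xL _; rewrite lee_fin Kf0 ?latticeB.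
  by apply: eq_esum => x _; rewrite -sumEFin; apply: eq_bigr => i _; rewrite mxE.
transitivity (\sum_i \esum_(x in lattice dx) ((K *m f x) i 0)%R%:E)%E.
  apply: eq_bigr => i _.
  exact: (esum_lattice_shift (fun x => ((K *m f x) i 0)%:E)).
rewrite -esum_sum; last by move=> x i /mem_set xL _; rewrite lee_fin Kf0.
apply: eq_esum => x _; rewrite sumEFin; congr (_%:E).
under eq_bigr do rewrite mxE.
rewrite exchange_big; apply: eq_bigr => j _.
by rewrite -mulr_suml K1 mul1r.
Qed.

Lemma total_mass_delta j :
  total_mass dx (fun x => if x == 0 then delta_mx j 0 else 0) = 1%:E.
Proof.
transitivity (\esum_(x in [set 0%R : 'rV[R]_2]%classic) (1%:E : \bar R))%E; last first.
  by rewrite esum_set1 ?lee_fin.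
rewrite /total_mass esum_mkcond [RHS]esum_mkcond; apply: eq_esum => x _.
have -> : (x \in [set (0 : 'rV[R]_2)]%classic) = (x == 0).
  by apply/idP/eqP; rewrite inE.
case: (eqVneq x 0) => [->|_]; last by rewrite big1 ?if_same// => i _; rewrite mxE.
rewrite lattice0 (bigD1 j)//= mxE !eqxx big1 ?addr0// => i /negPf ij.
by rewrite mxE ij.
Qed.

(** For necessity, the datum with all its mass in component j of the node 0
    takes after one step the value K i j at the node w i, in component i. *)
Lemma Linfty_stable_transport : (forall j, \sum_i K i j = 1) ->
  Linfty_stable dx (transport_step K w) <-> forall i j, 0 <= K i j.
Proof.
move=> K1; split=> [stab i j | K0 C _ f f0 fC n].
  pose f x : 'cV[R]_4 := if x == 0 then delta_mx j 0 else 0.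
  have f0 : nonneg_on_lattice dx f.
    by move=> x _ k; rewrite /f; case: ifP; rewrite mxE ?ler0n.
  have fm : (total_mass dx f <= 1%:E)%E by rewrite total_mass_delta.
  have [/(_ _ (wL i) i)] := stab 1 ltr01 f f0 fm 1.
  by rewrite /= /transport_step mxE subrr /f eqxx -colE mxE.
elim: n => //= n [g0 gC]; split; first exact: transport_step_ge0.
by rewrite total_mass_transport.
Qed.

End TransportSchemes.

(** * The collision matrix of the twisted scheme *)

Section TwistedCollision.
Variable R : realType.
Implicit Types (lam sq sxy : R) (V : 'rV[R]_2).

Definition sgnx (j : 'I_4) : R := [:: 1; -1; -1; 1]`_j.
Definition sgny (j : 'I_4) : R := [:: 1; 1; -1; -1]`_j.

Lemma velocityE lam j : velocity lam j = lam *: vec2 (sgnx j) (sgny j).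
Proof.
apply/rowP => k; case: j => [[|[|[|[|]]]]] //= ?; case: k => [[|[|]]] //= ?;
  by rewrite !mxE /= /sgnx /sgny /= ?mulr1 ?mulrN1.
Qed.

Definition twisted_mx lam sq sxy V : 'M[R]_4 := \matrix_(i, j) (4^-1 * (1
  + sgnx i * ((1 - sq) * sgnx j + sq * (V 0 0 / lam))
  + sgny i * ((1 - sq) * sgny j + sq * (V 0 1 / lam))
  + (1 - sxy) * (sgnx i * sgny i * (sgnx j * sgny j)))).

Definition moment_inv lam : 'M[R]_4 := \matrix_(i, k) (4^-1 *
  [:: 1; sgnx i / lam; sgny i / lam; sgnx i * sgny i / lam ^+ 2]`_k).

(** The rows of signs 1, sgnx, sgny, sgnx sgny are pairwise orthogonal of
    squared norm 4, which gives [moment_inv] as inverse once the powers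
    of lam are undone. *)
Lemma moment_mxE lam k j : moment_mx lam 0 k j =
  [:: 1; lam * sgnx j; lam * sgny j; lam ^+ 2 * (sgnx j * sgny j)]`_k.
Proof.
rewrite mxE velocityE subr0 /moment_poly !mxE /=.
by case: k => [[|[|[|[|]]]]] //= _; ring.
Qed.

Lemma moment_invE lam : lam != 0 -> invmx (moment_mx lam 0) = moment_inv lam.
Proof.
move=> lam0.
have MN : moment_mx lam 0 *m moment_inv lam = 1%:M.
  apply: mulmx1C; apply/matrixP => i j.
  rewrite mxE !big_ord_recl big_ord0 !moment_mxE !mxE /=.
  case: i => [[|[|[|[|]]]]] //= hi; case: j => [[|[|[|[|]]]]] //= hj;
  rewrite /sgnx /sgny /= ?mulr1n ?mulr0n; by field.
have [uM _] := mulmx1_unit MN.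
by rewrite -[RHS](mulKmx uM) MN mulmx1.
Qed.

Lemma collideE lam sq sxy V f : lam != 0 ->
  collide lam 0 (vec4 0 sq sq sxy) (vec4 1 (V 0 0) (V 0 1) 0) f
  = twisted_mx lam sq sxy V *m f.
Proof.
move=> lam0; rewrite /collide moment_invE//; apply/colP => i.
rewrite mxE !big_ord_recl big_ord0 !mxE /density !big_ord_recl !big_ord0.
rewrite !moment_mxE !mxE /=.
case: i => [[|[|[|[|]]]]] //= hi; rewrite /sgnx /sgny /=; by field.
Qed.

(** The corners are numbered cyclically, so two distinct ones are adjacent
    exactly when their indices have different parities. *)
Definition margin sq sxy (i j : 'I_4) : R :=
  if i == j then 4 - 2 * sq - sxy
  else if odd (i + j) then sxy else 2 * sq - sxy.

Lemma twisted_mx_margin lam sq sxy V i j : lam != 0 ->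
  4 * lam * twisted_mx lam sq sxy V i j
  = lam * margin sq sxy i j + sq * (sgnx i * V 0 0 + sgny i * V 0 1).
Proof.
move=> lam0; rewrite mxE /margin -val_eqE.
case: i => [[|[|[|[|]]]]] //= hi; case: j => [[|[|[|[|]]]]] //= hj;
  rewrite /sgnx /sgny /=; by field.
Qed.

Lemma twisted_mx_colsum lam sq sxy V j :
  \sum_i twisted_mx lam sq sxy V i j = 1.
Proof.
rewrite !big_ord_recl big_ord0 !mxE.
move: (sgnx j) (sgny j) (V 0 0 / lam) (V 0 1 / lam) => a b u v.
by rewrite /sgnx /sgny /=; field.
Qed.

Lemma sgn_dot_ge sq V i :
  - (`|sq| * norm1 V) <= sq * (sgnx i * V 0 0 + sgny i * V 0 1).
Proof.
rewrite /norm1 mulrDr -!normrM mulrDr opprD.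
have nrm (u x : R) : `|u| = 1 -> - `|sq * x| <= sq * (u * x).
  move=> u1; rewrite mulrCA lerNl (le_trans (ler_norm _))// normrN normrM u1.
  by rewrite mul1r.
by rewrite lerD// nrm//; case: i => [[|[|[|[|]]]]] //= hi;
  rewrite /sgnx /sgny /= ?normrN normr1.
Qed.

(** The minimum is reached at the corner whose signs are opposite to those of
    the vector sq V. *)
Lemma sgn_dot_min sq V : exists i,
  sq * (sgnx i * V 0 0 + sgny i * V 0 1) = - (`|sq| * norm1 V).
Proof.
rewrite /norm1 mulrDr -!normrM.
case: (ger0P (sq * V 0 0)) => hx; case: (ger0P (sq * V 0 1)) => hy;
  [ exists (inord 2) | exists (inord 1) | exists (inord 3) | exists (inord 0) ];
  rewrite /sgnx /sgny !inordK//=; ring.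
Qed.

Lemma twisted_mx_ge0P lam sq sxy V : 0 < lam ->
  (forall i j, 0 <= twisted_mx lam sq sxy V i j) <->
  [/\ `|sq| * norm1 V <= lam * sxy,
      `|sq| * norm1 V <= lam * (2 * sq - sxy) &
      `|sq| * norm1 V <= lam * (4 - 2 * sq - sxy)].
Proof.
move=> lam0.
have A0 i j : (0 <= twisted_mx lam sq sxy V i j) =
    (0 <= lam * margin sq sxy i j + sq * (sgnx i * V 0 0 + sgny i * V 0 1)).
  by rewrite -twisted_mx_margin ?gt_eqF// pmulr_rge0// mulr_gt0.
split=> [Kge0 | [h1 h2 h3] i j]; last first.
  have hm : `|sq| * norm1 V <= lam * margin sq sxy i j.
    by rewrite /margin; case: ifP => // _; case: ifP.
  by rewrite A0 -lerBlDl sub0r (le_trans _ (sgn_dot_ge sq V i))// lerN2.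
(* On the row where the drift is smallest, the corners i + 1, i + 2 and i give
   the three constants in the order of the conclusion. *)
have [i imin] := sgn_dot_min sq V.
have bound j : `|sq| * norm1 V <= lam * margin sq sxy i j.
  by move: (Kge0 i j); rewrite A0 imin subr_ge0.
move: (bound (inord ((i + 1) %% 4))) (bound (inord ((i + 2) %% 4))) (bound i).
rewrite /margin eqxx -!val_eqE.
by case: i {imin bound} => [[|[|[|[|]]]]] //= hi; rewrite !inordK //=.
Qed.

End TwistedCollision.

(** * Stability domain *)

Section Stability.
Variables (R : realType) (dx dt lam : R).
Hypotheses (dx_gt0 : 0 < dx) (dt_gt0 : 0 < dt) (lamE : lam = dx / dt).
Implicit Types (sq sxy t : R) (V : 'rV[R]_2).

Let lam_gt0 : 0 < lam. Proof. by rewrite lamE divr_gt0. Qed.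

Lemma hop_lattice j : dt *: velocity lam j \in lattice dx.
Proof.
pose z : 'rV[int]_2 := \row_k
  [:: [:: 1; -1; -1; 1 : int]`_j; [:: 1; 1; -1; -1 : int]`_j]`_k.
rewrite inE; exists z => //; apply/rowP => k.
have dtlam : dx = dt * lam by rewrite lamE mulrC divfK ?gt_eqF.
rewrite velocityE !mxE mulrA -dtlam; congr (_ * _).
by case: j @z => [[|[|[|[|]]]]] //= hj; case: k => [[|[|]]] //= hk.
Qed.

Lemma twisted_D2Q4E sq sxy V : twisted_D2Q4 lam dt sq sxy V
  = transport_step (twisted_mx lam sq sxy V) (fun j => dt *: velocity lam j).
Proof.
apply/funext => f; apply/funext => x; apply/colP => i.
by rewrite mxE collideE ?gt_eqF// [RHS]mxE.
Qed.

Lemma twisted_stableP sq sxy V :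
  Linfty_stable dx (twisted_D2Q4 lam dt sq sxy V) <->
  [/\ `|sq| * norm1 V <= lam * sxy,
      `|sq| * norm1 V <= lam * (2 * sq - sxy) &
      `|sq| * norm1 V <= lam * (4 - 2 * sq - sxy)].
Proof.
rewrite twisted_D2Q4E (Linfty_stable_transport hop_lattice); first exact: twisted_mx_ge0P.
exact: twisted_mx_colsum.
Qed.

(** Each of the first three regions is treated with t the smallest of the three
    right-hand sides there. *)
Lemma twisted_stable_sufficient t sq sxy V : 0 < sq ->
    t <= sxy -> t <= 2 * sq - sxy -> t <= 4 - 2 * sq - sxy ->
  norm1 V <= lam * (t / sq) -> Linfty_stable dx (twisted_D2Q4 lam dt sq sxy V).
Proof.
move=> sq0 t1 t2 t3 Vt; apply/twisted_stableP.
have {}Vt : `|sq| * norm1 V <= lam * t.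
  by rewrite gtr0_norm// mulrC -ler_pdivlMr// -mulrA.
by split; rewrite (le_trans Vt)// ler_wpM2l// ltW.
Qed.

Lemma twisted_stable_necessary sq sxy V :
  Linfty_stable dx (twisted_D2Q4 lam dt sq sxy V) ->
  [/\ 0 <= sxy, sxy <= 2 * sq & sxy <= 4 - 2 * sq].
Proof.
move/twisted_stableP => [h1 h2 h3].
have N0 : 0 <= `|sq| * norm1 V by rewrite mulr_ge0// addr_ge0.
have ge0 c : `|sq| * norm1 V <= lam * c -> 0 <= c.
  by move/(le_trans N0); rewrite pmulr_rge0.
by split; [exact: ge0 | rewrite -subr_ge0 ge0 | rewrite -subr_ge0 ge0].
Qed.

End Stability.


Theorem proposition3p7 (R : realType) (dx dt lam : R)
    (dx_gt0 : 0 < dx) (dt_gt0 : 0 < dt) (lamE : lam = dx / dt) (sq sxy : R) :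
  let gamma := sxy / sq in
  let stable (V : 'rV[R]_2) := Linfty_stable dx (twisted_D2Q4 lam dt sq sxy V) in
  let region1 := [&& 0 <= sxy, sxy <= Num.min sq (2 - sq) & sq != 0] in
  let region2 := [&& sq <= Num.min 1 sxy, sxy <= 2 * sq & sq != 0] in
  let region3 := (Num.max 1 (2 - sxy) <= sq) && (sxy <= 2 * (2 - sq)) in
  let region4 := (sxy == 0) && (sq == 0) in
  [/\ region1 -> forall V, norm1 V <= lam * gamma -> stable V,
      region2 -> forall V, norm1 V <= lam * (2 - gamma) -> stable V,
      region3 -> forall V, norm1 V <= lam * (4 / sq - 2 - gamma) -> stable V,
      region4 -> forall V, stable V &
      ~~ [|| region1, region2, region3 | region4] -> ~ exists V, stable V]
  /\ ((exists V, stable V) -> 0 <= sq <= 2 /\ 0 <= sxy <= 2).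
Proof.
move=> gamma stable region1 region2 region3 region4.
have stab_of := twisted_stable_sufficient dx_gt0 dt_gt0 lamE.
have nec V : stable V -> [/\ 0 <= sxy, sxy <= 2 * sq & sxy <= 4 - 2 * sq].
  exact: twisted_stable_necessary.
split; last by move=> [V /nec [? ? ?]]; split; apply/andP; split; lra.
rewrite /region1 /region2 /region3 /region4 !le_min ge_max; split.
- move=> /and3P[sxy0 /andP[le1 le2] sqN0] V.
  have sq0 : 0 < sq by rewrite lt_def sqN0 (le_trans sxy0).
  by apply: (stab_of sxy) => //; lra.
- move=> /and3P[/andP[le1 le2] le3 sqN0] V.
  have sq0 : 0 < sq by rewrite lt_def sqN0; lra.
  have -> : 2 - gamma = (2 * sq - sxy) / sq by rewrite /gamma; field.
  by apply: (stab_of (2 * sq - sxy)) => //; lra.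
- move=> /andP[/andP[le1 le2] le3] V.
  have sq0 : 0 < sq by lra.
  have -> : 4 / sq - 2 - gamma = (4 - 2 * sq - sxy) / sq.
    by rewrite /gamma; field; rewrite gt_eqF.
  by apply: (stab_of (4 - 2 * sq - sxy)) => //; lra.
- move=> /andP[/eqP sxy0 /eqP sq0] V.
  apply/(twisted_stableP dx_gt0 dt_gt0 lamE); rewrite sq0 sxy0 normr0 mul0r.
  by rewrite !mulr0 !subr0 mulr0 lexx mulr_ge0// lamE ltW// divr_gt0.
- move=> /negP nreg [V /nec [sxy0 le2 le3]]; apply: nreg; apply/or4P.
  have [sq0|sqN0] := eqVneq sq 0.
    by apply: Or44; rewrite andbT; apply/eqP; lra.
  have [sq1|sq1] := lerP sq 1.
    have [lt_sq|_] := ltP sxy sq.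
      by apply: Or41; rewrite sxy0 ltW//= andbT; lra.
    by apply: Or42; rewrite le2.
  have [le_2sq|gt_2sq] := lerP sxy (2 - sq).
    by apply: Or41; rewrite sxy0 andbT /=; lra.
  by apply: Or43; lra.
Qed.
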